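(* Let $G$ be a group, $\{H_i\}_{i\in I}$ a collection of subgroups of $G$ with $|I|\ge 2$, and $X$ a relative generating set of $G$ with respect to $\{H_i\}_{i\in I}$ such that $G$ is weakly hyperbolic relative to $\{H_i\}_{i\in I}$ and $X$. Let $\mathcal A=X\sqcup\mathcal H$, where $\mathcal H=\bigsqcup_{i\in I}H_i$, and fix two distinct members $H_1,H_2$ of the collection, with associated generalized metrics $\widehat{\mathrm d}_1$, $\widehat{\mathrm d}_2$. Let $D$ be the polygon constant described in the context. Let $\varepsilon\ge 0$, $\mu\in(0,1)$, $\rho\in\mathbf{N}$ be any constants and let $\{x_i\mid i\in K\}$ be a subset of $X\setminus H_2H_1$. Suppose that $$H_1\cap H_2\leqslant C_G(H_1)\cap C_G(H_2)\cap\Bigl(\bigcap_{i\in K}C_G(x_i)\Bigr).$$ Then for all sufficiently large natural numbers $m$ the following holds. Let $\mathcal R$ denote the symmetrization of a set of words in the alphabet $\mathcal A$ of the form $$x_ia_{i1}b_{i1}\ldots a_{im}b_{im},\quad i\in K,$$ where the following conditions hold. (a) For all $i\in K$ and $j\in\{1,\ldots,m\}$, we have $a_{ij}\in H_1$, $b_{ij}\in H_2$, and $$\min\{\widehat{\mathrm d}_1(1,a_{ij}),\,\widehat{\mathrm d}_2(b_{ij},1)\}\ge 50D.$$ (b) If $a_{k\ell}a_{ij}^{\gamma}\in H_1\cap H_2$ or $b_{k\ell}b_{ij}^{\gamma}\in H_1\cap H_2$ for some $i,k\in K$, $j,\ell\in\{1,\ldots,m\}$, and $\gamma=\pm1$,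 then $i=k$, $j=\ell$ and $\gamma=-1$. Then $\mathcal R$ satisfies the small cancellation condition $C_1(\varepsilon,\mu,\rho)$ over $G$.
   Context: Relative Cayley graphs. A relative generating set of $G$ with respect to subgroups $\{H_i\}_{i\in I}$ is a subset $X\subseteq G$ such that $X\cup\bigcup_i H_i$ generates $G$; all (relative) generating sets are assumed symmetric (closed under inversion). Put $\mathcal H=\bigsqcup_{i\in I}H_i$ and $\mathcal A=X\sqcup\mathcal H$ (disjoint unions of abstract sets, with the natural, possibly non-injective, map $\mathcal A\to G$). The Cayley graph $\Gamma(G,\mathcal A)$ has vertex set $G$ and, for all $g\in G$, $a\in\mathcal A$, an oriented edge from $g$ to $ga$ labeled by $a$; it is a metric space with edges of length $1$. Each $\Gamma(H_i,H_i)$ is naturally a subgraph of $\Gamma(G,\mathcal A)$. $G$ is weakly hyperbolic relative to $\{H_i\}_{i\in I}$ and $X$ if $\Gamma(G,\mathcal A)$ is a (Gromov) hyperbolic metric space. For $g,h\in H_i$, $\widehat{\mathrm d}_i(g,h)\in[0,\infty]$ is the length of a shortest path in $\Gamma(G,\mathcal A)$ connecting $g$ to $h$ and containing no edges of $\Gamma(H_i,H_i)$ ($\infty$ if there is no such path). The constant $D$. An $H_i$-component of a combinatorial path $p$ in $\Gamma(G,\mathcal A)$ is a non-trivial subpath $q$ of $p$ whose label is a word in the alphabet $H_i$ and which is not contained in a longer subpath of $p$ with this property. Two $H_i$-components are connected if all their vertices belong to the same coset $gH_i$; an $H_i$-component of $p$ is isolated if no distinct $H_i$-component of $p$ is connected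 to it. A geodesic $n$-gon is a closed circuit consisting of $n$ geodesic segments. Since $\Gamma(G,\mathcal A)$ is hyperbolic, it is known (Dahmani–Guirardel–Osin) that there is a constant $D$ such that for any combinatorial geodesic $n$-gon $p$ in $\Gamma(G,\mathcal A)$, any $i\in I$ and any isolated $H_i$-component $q$ of $p$, the element $h\in H_i$ represented by the label of $q$ satisfies $\widehat{\mathrm d}_i(1,h)\le Dn$. $D$ denotes this constant. Small cancellation. For words $U,V$ in $\mathcal A$, $U\equiv V$ means equality as words, and $U=V$ in $G$ means they represent the same element of $G$; $\|W\|$ is the number of letters of $W$. A word is geodesic if any path in $\Gamma(G,\mathcal A)$ labeled by it is geodesic. If $W\equiv UV$, then $U$ is an initial subword of $W$. A set of words $\mathcal R$ is symmetric if for every $R\in\mathcal R$ it contains all cyclic shifts of $R^{\pm1}$; the symmetrization of a set of words is the smallest symmetric set of words containing it. For $\varepsilon\ge0$, $\mu\in(0,1)$, $\rho\in\mathbf N$, a symmetric set $\mathcal R$ of words in $\mathcal A$ satisfies $C_1(\varepsilon,\mu,\rho)$ over $G$ if: (A) all words in $\mathcal R$ are geodesic and have length at least $\rho$; (B) whenever two distinct words $R,R'\in\mathcal R$ have initial subwords $U$ and $U'$, respectively, such that $\max\{\|U\|,\|U'\|\}\ge\mu\min\{\|R\|,\|R'\|\}$ and $U'=YUZ$ in $G$ for some words $Y,Z$ in $\mathcal A$ with $\max\{\|Y\|,\|Z\|\}\le\varepsilon$, then $YRY^{-1}=R'$ in $G$; (C) whenever a word $R\in\mathcal R$ contains two disjoint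 subwords $U$ and $U'$ such that $U'=YUZ$ or $U'=YU^{-1}Z$ in $G$ for some words $Y,Z$ in $\mathcal A$ with $\max\{\|Y\|,\|Z\|\}\le\varepsilon$, then $\max\{\|U\|,\|U'\|\}<\mu\|R\|$. $C_G(S)$ denotes the centralizer of $S$ in $G$, and $H_2H_1=\{h_2h_1\mid h_2\in H_2,h_1\in H_1\}$. *)

(* Defs.v *)
From HB Require Import structures.
From mathcomp Require Import all_boot all_order all_algebra.
From mathcomp Require Import all_classical all_reals ereal interval_inference.

Set Implicit Arguments.
Unset Strict Implicit.
Unset Printing Implicit Defensive.
Import Order.TTheory GRing.Theory Num.Theory.

Local Open Scope classical_set_scope.
Local Open Scope group_scope.

Definition subgroup (G : groupType) (S : set G) : Prop := group_closed [in S].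

Definition generates (G : groupType) (A : set G) : Prop :=
  smallest (@subgroup G) A = setT.

Definition centralizer (G : groupType) (S : set G) : set G :=
  [set g | forall s, S s -> commute g s].

(* [sgnpow g c] is g ^ ((-1) ^ c): the exponent is 1 for [c = false] and -1 for
   [c = true]. *)
Definition sgnpow (G : groupType) (g : G) (c : bool) : G :=
  if c then g^-1 else g.

Section GromovHyperbolicity.
Local Open Scope ring_scope.
Context (R : realType) (T : Type) (d : T -> T -> R).

Definition gromov_product (x y w : T) : R := (d x w + d y w - d x y) / 2.

Definition gromov_hyperbolic : Prop :=
  exists delta : R, forall x y z w : T,
    Num.min (gromov_product x y w) (gromov_product y z w) - delta
      <= gromov_product x z w.

End GromovHyperbolicity.

Section RelativeCayleyGraph.
Context (G : groupType) (I : Type).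
(* [invgClosed] makes X symmetric; [groupClosed] makes each H i a subgroup. *)
Context (X : invgClosed G) (H : I -> groupClosed G).

Definition relative_generating : Prop :=
  generates ([set` X] `|` \bigcup_i [set` H i]).

(* The disjoint union of X and of the H i: equal elements of G coming from
   distinct pieces are distinct letters. *)
Inductive letter : Type :=
  | Xletter of {x : G | x \in X}
  | Hletter (i : I) of {h : G | h \in H i}.

Definition letter_val (a : letter) : G :=
  match a with Xletter x => val x | Hletter _ h => val h end.

Lemma Xinv_subproof (x : {x : G | x \in X}) : (val x)^-1 \in X.
Proof. exact: gpredVr (valP x). Qed.

Lemma Hinv_subproof i (h : {h : G | h \in H i}) : (val h)^-1 \in H i.
Proof. exact: gpredVr (valP h). Qed.

Definition letter_inv (a : letter) : letter :=
  match a with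
  | Xletter x => Xletter (exist _ (val x)^-1 (Xinv_subproof x))
  | Hletter i h => Hletter (exist _ (val h)^-1 (Hinv_subproof h))
  end.

Definition word : Type := seq letter.

Definition word_val (w : word) : G := \prod_(a <- w) letter_val a.

Definition word_inv (w : word) : word := rev (map letter_inv w).

(* A combinatorial path is given by its origin g and its label w. Traversing
   the edge (g, a) backwards is the same as following the edge
   (g a, a^-1), as the alphabet is symmetric. *)
Definition vertex (g : G) (w : word) (j : nat) : G := g * word_val (take j w).

Definition geodesic_path (g : G) (w : word) : Prop :=
  forall w' : word, g * word_val w' = g * word_val w -> size w <= size w'.

Definition geodesic_word (w : word) : Prop := forall g, geodesic_path g w.

Definition H_word (i : I) (w : word) : Prop :=
  exists s : seq {h : G | h \in H i}, w = map (@Hletter i) s.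

(* The subpath of a path labeled w which runs from its k-th to its l-th vertex
   is encoded by the pair (k, l); this is its label. *)
Definition subword (w : word) (k l : nat) : word := drop k (take l w).

Definition H_subpath (i : I) (w : word) (k l : nat) : Prop :=
  [/\ k < l, l <= size w & H_word i (subword w k l)].

Definition H_component (i : I) (w : word) (k l : nat) : Prop :=
  H_subpath i w k l /\
  forall k' l', k' <= k -> l <= l' -> H_subpath i w k' l' ->
    k' = k /\ l' = l.

Definition connected_components (i : I) (g : G) (w : word) (k l k' l' : nat)
    : Prop :=
  exists c : G, forall j, (k <= j <= l) || (k' <= j <= l') ->
    c^-1 * vertex g w j \in H i.

Definition isolated_component (i : I) (g : G) (w : word) (k l : nat) : Prop :=
  H_component i w k l /\
  forall k' l', H_component i w k' l' ->
    connected_components i g w k l k' l' -> k' = k /\ l' = l.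

(* [ws] lists the labels of the sides of a polygon starting at g. *)
Definition geodesic_polygon (g : G) (ws : seq word) : Prop :=
  g * word_val (flatten ws) = g /\
  forall j, j < size ws ->
    geodesic_path (g * word_val (flatten (take j ws))) (nth [::] ws j).

Definition symmetric_words (W : set word) : Prop :=
  forall w n, W w -> W (rot n w) /\ W (rot n (word_inv w)).

Definition symmetrization (W : set word) : set word :=
  smallest symmetric_words W.

(* No edge of the path is an edge of the subgraph Γ(H i, H i). *)
Definition avoids (i : I) (g : G) (w : word) : Prop :=
  forall (u v : word) (h : {h : G | h \in H i}),
    w = u ++ Hletter h :: v -> g * word_val u \notin H i.

Section Metric.
Local Open Scope ring_scope.
Context (R : realType).

Definition vertex_dist (g h : G) : R :=
  inf [set (size w)%:R | w in [set w : word | (g * word_val w)%g = h]].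

(* Points of the metric realization of the Cayley graph: (g, a, t) is the point
   at distance t from the origin of the edge from g to g a labeled by a. Distinct
   triples may name the same vertex, so the distance below is a
   pseudo-distance on triples. *)
Definition cayley_point : Type := (G * letter * {i01 R})%type.

Definition endpoint (p : cayley_point) (e : bool) : G :=
  if e then (p.1.1 * letter_val p.1.2)%g else p.1.1.

Definition to_endpoint (p : cayley_point) (e : bool) : R :=
  if e then 1 - p.2%:num else p.2%:num.

Definition cayley_dist (p q : cayley_point) : R :=
  let via e f :=
    to_endpoint p e + vertex_dist (endpoint p e) (endpoint q f)
      + to_endpoint q f in
  let r := Num.min (Num.min (via false false) (via false true))
                   (Num.min (via true false) (via true true)) in
  if `[< p.1 = q.1 >] then Num.min `|p.2%:num - q.2%:num| r else r.

Definition weakly_hyperbolic : Prop := gromov_hyperbolic cayley_dist.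

Definition dhat (i : I) (g h : G) : \bar R :=
  ereal_inf [set (size w)%:R%:E | w in
    [set w : word | (g * word_val w)%g = h /\ avoids i g w]].

Definition polygon_constant (D : R) : Prop :=
  forall (g : G) (ws : seq word) (i : I) (k l : nat),
    geodesic_polygon g ws ->
    isolated_component i g (flatten ws) k l ->
    (dhat i 1%g (word_val (subword (flatten ws) k l))
       <= (D * (size ws)%:R)%:E)%E.

Definition C1_A (rho : nat) (W : set word) : Prop :=
  forall r : word, W r -> geodesic_word r /\ (rho <= size r)%N.

Definition C1_B (epsilon mu : R) (W : set word) : Prop :=
  forall r r' u v u' v' y z : word,
    W r -> W r' -> r <> r' ->
    r = u ++ v -> r' = u' ++ v' ->
    mu * (minn (size r) (size r'))%:R <= (maxn (size u) (size u'))%:R ->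
    word_val u' = word_val (y ++ u ++ z) ->
    (maxn (size y) (size z))%:R <= epsilon ->
    word_val (y ++ r ++ word_inv y) = word_val r'.

Definition disjoint_subwords (r u u' : word) : Prop :=
  exists p s t : word, r = p ++ u ++ s ++ u' ++ t \/ r = p ++ u' ++ s ++ u ++ t.

Definition C1_C (epsilon mu : R) (W : set word) : Prop :=
  forall r u u' y z : word,
    W r -> disjoint_subwords r u u' ->
    word_val u' = word_val (y ++ u ++ z) \/
    word_val u' = word_val (y ++ word_inv u ++ z) ->
    (maxn (size y) (size z))%:R <= epsilon ->
    (maxn (size u) (size u'))%:R < mu * (size r)%:R.

Definition small_cancellation_C1 (epsilon mu : R) (rho : nat) (W : set word)
    : Prop :=
  [/\ C1_A rho W, C1_B epsilon mu W & C1_C epsilon mu W].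

End Metric.

(* The word x a_0 b_0 ... a_(m-1) b_(m-1). *)
Definition relator (i1 i2 : I) (m : nat) (x : {x : G | x \in X})
    (a : 'I_m -> {h : G | h \in H i1}) (b : 'I_m -> {h : G | h \in H i2})
    : word :=
  Xletter x :: flatten [seq [:: Hletter (a j); Hletter (b j)] | j <- enum 'I_m].

End RelativeCayleyGraph.

Arguments weakly_hyperbolic {G I} X H R.
Arguments dhat {G I} X H {R} i g h.
Arguments polygon_constant {G I} X H {R} D.
Arguments relative_generating {G I} X H.

(* Main.v *)
Require Import Defs.
From HB Require Import structures.
From mathcomp Require Import all_boot all_order all_algebra.
From mathcomp Require Import all_classical all_reals.
From mathcomp Require Import ereal zify.

Import Order.TTheory GRing.Theory Num.Theory.
Local Open Scope classical_set_scope.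
Local Open Scope ring_scope.

(** Call an edge labeled by a letter of H_1 or of H_2 long if its label h
   satisfies h <> 1 and 50 D <= dhat(1, h). The polygon constant says that in a
   geodesic polygon with fewer than 50 sides no long edge is an isolated
   component: some other edge of the polygon, labeled in the same H_i, has its
   vertices in the same coset of H_i ([polygon_coset]). Since such a coset has
   diameter at most one, a geodesic crosses it along at most one edge
   ([geodesic_coset_once]), so that other edge lies on another side. Everything
   follows from these two facts applied to polygons with at most four sides.

   Relators are geodesic. All their letters but x_i are long: condition (b),
   applied to a letter and itself with exponent 1, keeps them out of H_1 /\ H_2,
   and in particular away from 1. Let w be a shortest non-geodesic subword of a
   relator, with |w| >= 3, and let c be a geodesic with the same ends. If an
   interior letter of w is long, the triangle formed by w without its last
   letter, that last letter, and c shows that it shares a coset with an edge of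
   c. As w minus its first letter and w minus its last letter are geodesic, the
   parts of c before and after that edge are at least as long as those of w,
   whence |w| <= |c| ([geodesic_interior_edge]). The words left over are those
   of length at most two and the words b x a ([geodesic_turn]); these are treated
   by hand, using that x lies outside H_2 H_1.

   Pieces. Suppose that u' = y u z with u and u' long subwords of relators and
   with y and z short. In the quadrilateral y, u, z, u'^-1, each long edge of u
   far from the ends of u shares a coset with an edge of u'. Consecutive edges
   of u are sent to adjacent edges of u', nothing is visited twice, and the
   correspondence moves every position by a bounded amount, so that it is
   increasing somewhere ([parallel_run]). Where an edge of u and its two
   neighbors correspond to three consecutive edges of u', the vertices in
   between differ by elements of Z := H_1 /\ H_2, hence so do the two middle
   labels, as Z is central; condition (b) then makes them the same letter of the
   same relator ([aligned_edges]). For (B) this aligns the two relators up to a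
   conjugation, because Z centralizes all letters; for (C) it contradicts the
   fact that each letter occurs only once in a relator. *)

(** * Words and the vertices that they visit *)

Section Words.

Local Open Scope nat_scope.
Local Open Scope group_scope.
Set Implicit Arguments.
Unset Strict Implicit.
Unset Printing Implicit Defensive.

Context (G : groupType) (I : Type).
Context (X : invgClosed G) (H : I -> groupClosed G).

Local Notation letter := (letter X H).
Local Notation word := (word X H).
Implicit Types (a : letter) (u v w y z : word) (i : I) (g h : G).

Definition same_coset i g h : Prop := g^-1 * h \in H i.

Lemma coset_sym i g h : same_coset i g h -> same_coset i h g.
Proof. by rewrite /same_coset -gpredV invgM invgK. Qed.

Lemma coset_trans i g h k :
  same_coset i g h -> same_coset i h k -> same_coset i g k.
Proof.
move=> gh hk; rewrite /same_coset -(mulVKg h k) mulgA.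
by rewrite gpredM.
Qed.

Lemma coset_mull i k g h : same_coset i (k * g) (k * h) <-> same_coset i g h.
Proof. by rewrite /same_coset invgM -mulgA mulKg. Qed.

Definition vert w j : G := word_val (take j w).

Lemma word_val_nil : word_val ([::] : word) = 1.
Proof. by rewrite /word_val big_nil. Qed.

Lemma word_val_cons a w : word_val (a :: w) = letter_val a * word_val w.
Proof. by rewrite /word_val big_cons. Qed.

Lemma word_val1 a : word_val [:: a] = letter_val a.
Proof. by rewrite word_val_cons word_val_nil mulg1. Qed.

Lemma word_val_cat u v : word_val (u ++ v) = word_val u * word_val v.
Proof. by rewrite /word_val big_cat. Qed.

Lemma letter_val_inv a : letter_val (letter_inv a) = (letter_val a)^-1.
Proof. by case: a. Qed.

Lemma letter_invK : involutive (@letter_inv G I X H).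
Proof.
by case=> [x|i h] /=; congr (_ _); apply: val_inj; rewrite /= invgK.
Qed.

Lemma size_word_inv w : size (word_inv w) = size w.
Proof. by rewrite size_rev size_map. Qed.

Lemma word_inv_cat u v : word_inv (u ++ v) = word_inv v ++ word_inv u.
Proof. by rewrite /word_inv map_cat rev_cat. Qed.

Lemma word_invK : involutive (@word_inv G I X H).
Proof.
by move=> w; rewrite /word_inv map_rev revK mapK //; apply: letter_invK.
Qed.

Lemma word_val_inv w : word_val (word_inv w) = (word_val w)^-1.
Proof.
elim: w => [|a w IH]; first by rewrite word_val_nil invg1.
rewrite -cat1s word_inv_cat !word_val_cat IH invgM word_val1; congr (_ * _).
by rewrite /word_inv /= word_val1 letter_val_inv.
Qed.

Lemma vert0 w : vert w 0 = 1.
Proof. by rewrite /vert take0 word_val_nil. Qed.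

Lemma vert_size w : vert w (size w) = word_val w.
Proof. by rewrite /vert take_size. Qed.

Lemma vertS w j a : onth w j = Some a -> vert w j.+1 = vert w j * letter_val a.
Proof.
move=> wj; have jw : j < size w by rewrite -onthTE wj.
by rewrite /vert (take_nth a jw) -cats1 word_val_cat word_val1 (@onth_nth _ a _ _ _ wj).
Qed.

Lemma vert_catl u v j : j <= size u -> vert (u ++ v) j = vert u j.
Proof.
move=> ju; rewrite /vert take_cat; case: ltnP => // uj.
have -> : j = size u by lia.
by rewrite subnn take0 cats0 take_size.
Qed.

Lemma vert_catr u v j : vert (u ++ v) (size u + j) = word_val u * vert v j.
Proof.
by rewrite /vert take_cat ifN ?addKn ?word_val_cat // -leqNgt leq_addr.
Qed.

Lemma vert_inv w j : j <= size w ->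
  vert (word_inv w) j = (word_val w)^-1 * vert w (size w - j).
Proof.
move=> jw; rewrite /vert /word_inv take_rev size_map -map_drop -/(word_inv _).
rewrite word_val_inv -[in (word_val w)^-1](cat_take_drop (size w - j) w).
by rewrite word_val_cat invgM mulgVK.
Qed.

Definition within_dist n g h : Prop :=
  exists w : word, size w <= n /\ g * word_val w = h.

Lemma within_dist_trans m n g h k : within_dist m g h -> within_dist n h k -> within_dist (m + n) g k.
Proof.
move=> [u [su <-]] [v [sv <-]]; exists (u ++ v).
by rewrite size_cat leq_add // word_val_cat mulgA.
Qed.

Lemma within_dist_sym n g h : within_dist n g h -> within_dist n h g.
Proof.
move=> [u [su <-]]; exists (word_inv u).
by rewrite size_word_inv word_val_inv mulgK.
Qed.

Lemma within_dist_mull k n g h : within_dist n (k * g) (k * h) <-> within_dist n g h.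
Proof.
split=> -[w [sw e]]; exists w; split=> //; last by rewrite -mulgA e.
by apply: (mulgI k); rewrite mulgA.
Qed.

Lemma within_dist_H i g h : same_coset i g h -> within_dist 1 g h.
Proof.
move=> gh; exists [:: @Hletter G I X H i (exist (fun h => h \in H i) _ gh)].
by rewrite word_val1 /= mulVKg.
Qed.

Lemma within_dist_vert w j k : j <= k -> within_dist (k - j) (vert w j) (vert w k).
Proof.
move=> jk; exists (drop j (take k w)); split.
  by rewrite size_drop size_take; case: ifP => ?; lia.
rewrite /vert -[in RHS](cat_take_drop j (take k w)) word_val_cat.
by rewrite take_takel.
Qed.

Lemma geodesic_wordP w : geodesic_word w <->
  forall w' : word, word_val w' = word_val w -> size w <= size w'.
Proof.
split=> [gw w' e | gw g w' e]; first by apply: (gw 1); rewrite e.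
by apply: gw; apply: mulgI e.
Qed.

(** No shortcut joins two vertices of a geodesic; all the length estimates below
   are obtained by exhibiting a path and reading off this inequality. *)
Lemma geodesic_vert w j k n : geodesic_word w -> k <= size w ->
  within_dist n (vert w j) (vert w k) -> k <= j + n.
Proof.
move=> /geodesic_wordP gw kw [v [sv e]].
have := gw (take j w ++ v ++ drop k w).
rewrite !word_val_cat mulgA -/(vert w j) e /vert -word_val_cat cat_take_drop.
move=> /(_ erefl); rewrite !size_cat size_take size_drop.
case: ifP => ?; lia.
Qed.

Lemma geodesic_infix u v w : geodesic_word (u ++ v ++ w) -> geodesic_word v.
Proof.
move=> /geodesic_wordP g; apply/geodesic_wordP => v' e.
have := g (u ++ v' ++ w); rewrite !word_val_cat e !size_cat => /(_ erefl).
lia.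
Qed.

Lemma geodesic_inv w : geodesic_word w -> geodesic_word (word_inv w).
Proof.
move=> /geodesic_wordP g; apply/geodesic_wordP => v e.
rewrite size_word_inv -(size_word_inv v); apply: g.
by rewrite word_val_inv e word_val_inv invgK.
Qed.

Lemma geodesic_representative w :
  exists v : word, [/\ geodesic_word v, word_val v = word_val w & size v <= size w].
Proof.
have [n] := ubnP (size w); elim: n w => // n IH w wn.
have [/geodesic_wordP gw | ng] := pselect (geodesic_word w).
  by exists w; split=> //; apply/geodesic_wordP.
have [w' e lt] : exists2 w' : word, word_val w' = word_val w & size w' < size w.
  apply: contrapT => nex; apply: ng; apply/geodesic_wordP => w' e.
  by rewrite leqNgt; apply/negP => lt; apply: nex; exists w'.
have [|v [gv ev sv]] := IH w'; first by lia.
by exists v; split; rewrite // ?ev //; lia.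
Qed.

Definition H_at i w j : Prop := exists s, onth w j = Some (@Hletter G I X H i s).

Lemma H_at_lt i w j : H_at i w j -> j < size w.
Proof. by move=> [h e]; rewrite -onthTE e. Qed.

Lemma H_at_uniq i i' w j : H_at i w j -> H_at i' w j -> i = i'.
Proof. move=> [h e] [h' e']; by move: e; rewrite e' => -[]. Qed.

Lemma H_at_vert i w j : H_at i w j -> same_coset i (vert w j) (vert w j.+1).
Proof. by move=> [h e]; rewrite /same_coset (vertS e) mulKg (valP h). Qed.

Lemma H_at_cat i u v j :
  H_at i (u ++ v) j -> H_at i u j \/ size u <= j /\ H_at i v (j - size u).
Proof. by rewrite /H_at onth_cat; case: ltnP; [left | right]. Qed.

Lemma H_at_inv i w j :
  H_at i (word_inv w) j -> H_at i w (size w - j.+1).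
Proof.
move=> Hj; have := H_at_lt Hj; rewrite size_word_inv => jw; move: Hj => [h].
rewrite /H_at /word_inv onthE map_rev nth_rev ?size_map // -onthE onth_map.
case: onth => [a|] //= [e].
by exists (exist (fun h => h \in H i) _ (Hinv_subproof h)); rewrite -(letter_invK a) e.
Qed.

(** Two edges of one coset lie at distance at most one, so that a geodesic
   crosses each coset along at most one edge. *)
Lemma geodesic_coset_once i w j k : geodesic_word w ->
  H_at i w j -> H_at i w k -> same_coset i (vert w j) (vert w k) -> j = k.
Proof.
suff le j' k' : geodesic_word w -> H_at i w j' -> H_at i w k' ->
    same_coset i (vert w j') (vert w k') -> k' <= j'.
  by move=> gw Hj Hk jk; apply/eqP; rewrite eqn_leq !le //; apply: coset_sym.
move=> gw Hj Hk jk.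
have : k'.+1 <= j' + 1; last by lia.
apply: (geodesic_vert gw (H_at_lt Hk)); apply: (@within_dist_H i).
exact: coset_trans jk (H_at_vert Hk).
Qed.

End Words.

(** * The relative metric and geodesic polygons *)

Section RelativeMetric.

Local Open Scope nat_scope.
Local Open Scope group_scope.
Set Implicit Arguments.
Unset Strict Implicit.
Unset Printing Implicit Defensive.

Context (G : groupType) (I : Type).
Context (X : invgClosed G) (H : I -> groupClosed G).
Context (R : realType).

Local Notation letter := (letter X H).
Local Notation word := (word X H).
Implicit Types (a : letter) (u v w y z : word) (i : I) (g h : G).

Local Notation dhat := (@dhat G I X H R).

Lemma avoids_inv i g w :
  avoids i g w -> avoids i (g * word_val w) (word_inv w).
Proof.
move=> av u v h e.
have {}e : w = word_inv v ++ Hletter X (exist (fun h => h \in H i) _ (Hinv_subproof h))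
    :: word_inv u.
  by rewrite -(word_invK w) e -cat_rcons word_inv_cat -cats1 word_inv_cat.
have /= := av _ _ _ e.
rewrite e word_val_cat word_val_cons /= !word_val_inv !mulgA mulgVK.
by rewrite (gpredMr _ (Hinv_subproof h)).
Qed.

Lemma dhat_sym i g h : dhat i g h = dhat i h g.
Proof.
suff sub g' h' : (dhat i g' h' <= dhat i h' g')%E.
  by apply/eqP; rewrite eq_le !sub.
apply: ereal_inf_le_tmp => _ [w [<- av] <-].
exists (word_inv w); last by rewrite size_word_inv.
by split; [rewrite word_val_inv mulgK | exact: avoids_inv].
Qed.

Lemma dhat_mull i k g h : k \in H i -> dhat i (k * g) (k * h) = dhat i g h.
Proof.
suff sub k' g' h' : k' \in H i ->
    (dhat i g' h' <= dhat i (k' * g') (k' * h'))%E.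
  move=> Hk; apply/eqP; rewrite eq_le sub // andbT.
  by rewrite -{2}(mulKg k g) -{2}(mulKg k h) sub // gpredV.
move=> Hk; apply: ereal_inf_le_tmp => _ [w [e av] <-].
exists w => //; split; first by apply: (mulgI k'); rewrite mulgA.
by move=> u v s /av; rewrite -mulgA (gpredMl _ Hk).
Qed.

Lemma dhat_inv i h : h \in H i -> dhat i 1 h^-1 = dhat i 1 h.
Proof. by move=> Hh; rewrite -(dhat_mull _ _ Hh) mulgV mulg1 dhat_sym. Qed.

Lemma dhat_ge1 i h : h <> 1 -> (1%:E <= dhat i 1 h)%E.
Proof.
move=> h1; apply: le_ereal_inf_tmp => _ [w [e _] <-].
rewrite lee_fin (_ : 1%R = 1%:R) // ler_nat.
by case: w e => // e; case: h1; rewrite -e word_val_nil mulg1.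
Qed.

Lemma H_at_subpath i w k l j :
  H_subpath i w k l -> k <= j -> j < l -> H_at i w j.
Proof.
move=> [_ lw [s e]] kj jl.
have : onth (subword w k l) (j - k) = onth w j.
  rewrite /subword !onthE map_drop map_take nth_drop nth_take ?subnKC //.
rewrite e onth_map /H_at => <-; case E: onth => [c|] /=; first by exists c.
have := onthTE (subword w k l) (j - k); rewrite e onth_map E /= size_map.
have /(congr1 size) := e; rewrite size_map size_drop size_take.
case: ifP; lia.
Qed.

(** Excluding h = 1 keeps the notion meaningful when D = 0: any h <> 1 lies at
   relative distance at least one. *)
Definition dhat_long (D : R) i h : Prop :=
  h <> 1 /\ ((50 * D)%R%:E <= dhat i 1 h)%E.

(** If no other edge of the polygon met the coset, the k-th edge alone would be
   an isolated component, so that 1 <= dhat <= n D with n < 50. This forces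
   D > 0, and then 50 D <= n D is absurd. *)
Lemma polygon_coset (D : R) (ws : seq word) i k s :
  polygon_constant X H D ->
  (forall j, j < size ws -> geodesic_word (nth [::] ws j)) ->
  word_val (flatten ws) = 1 -> size ws < 50 ->
  onth (flatten ws) k = Some (@Hletter G I X H i s) -> dhat_long D i (val s) ->
  exists j, [/\ j <> k, H_at i (flatten ws) j
     & same_coset H i (vert (flatten ws) k) (vert (flatten ws) j)].
Proof.
set P := flatten ws => hD gws P1 ws50 Pk [s1 ds].
apply: contrapT => nex.
have kP : k < size P by rewrite -onthTE Pk.
have Hk : H_at i P k by exists s.
have sk : subword P k k.+1 = [:: Hletter X s].
  rewrite /subword (take_nth (Hletter X s)) // -cats1 (@onth_nth _ _ _ _ _ Pk).
  by rewrite drop_cat size_take kP ltnn subnn.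
have subk : H_subpath i P k k.+1 by split=> //; exists [:: s].
have compk : H_component i P k k.+1.
  split=> // k' l' k'k kl' sub.
  have [k'lt|k'ge] := ltnP k' k.
    exfalso; apply: nex; exists k.-1.
    have e : k.-1.+1 = k by lia.
    have Hk' : H_at i P k.-1 by apply: (H_at_subpath sub); lia.
    split=> //; first lia.
    by apply: coset_sym; have := H_at_vert Hk'; rewrite e.
  have [l'lt|l'ge] := ltnP k.+1 l'.
    exfalso; apply: nex; exists k.+1; split; first lia.
      by apply: (H_at_subpath sub); lia.
    exact: H_at_vert.
  by split; lia.
have iso : isolated_component i 1 P k k.+1.
  split=> // k' l' [sub mx] [c cP].
  have [e|/eqP ne] := eqVneq k' k.
    subst k'; split=> //.
    have [kl' _ _] := sub.
    by have [] := compk.2 k l' (leqnn k) kl' sub.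
  exfalso; apply: nex; exists k'.
  have [k'l' _ _] := sub.
  split=> //; first by apply: (H_at_subpath sub).
  have in_c m : (k <= m <= k.+1) || (k' <= m <= l') -> same_coset H i c (vert P m).
    by move=> /cP; rewrite /vertex mul1g.
  by apply: coset_trans (coset_sym (in_c k _)) (in_c k' _); rewrite leqnn ?leqnSn
    ?(ltnW k'l') ?orbT.
have poly : geodesic_polygon 1 ws.
  by split; [rewrite P1 mulg1 | move=> j /gws; apply].
have := hD 1 ws i k k.+1 poly iso.
rewrite sk word_val1 /= => dle.
have := le_trans (dhat_ge1 i s1) dle; have := le_trans ds dle.
rewrite !lee_fin => le50 le1.
have D0 : (0 < D)%R.
  rewrite ltNge; apply/negP => D0.
  have : (D * (size ws)%:R <= 0)%R by rewrite mulr_le0_ge0.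
  by move=> /(le_trans le1); rewrite ler10.
move: le50; rewrite mulrC ler_pM2l // ler_nat; lia.
Qed.

(** The same conclusion when one side is singled out and read in the opposite
   direction, as is natural for two paths with common or nearby endpoints. *)
Lemma polygon_coset_opposite (D : R) (ws : seq word) w (c : word) i k s :
  polygon_constant X H D -> flatten ws = w ->
  (forall j, j < size ws -> geodesic_word (nth [::] ws j)) -> size ws < 49 ->
  geodesic_word c -> word_val c = word_val w ->
  onth w k = Some (@Hletter G I X H i s) -> dhat_long D i (val s) ->
  (exists j, [/\ j <> k, H_at i w j
     & same_coset H i (vert w k) (vert w j)]) \/
  (exists2 t, H_at i c t & same_coset H i (vert w k) (vert c t)).
Proof.
move=> hD ew gws ws49 gc ec wk ss.
have kw : k < size w by rewrite -onthTE wk.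
have eP : flatten (rcons ws (word_inv c)) = w ++ word_inv c.
  by rewrite -cats1 flatten_cat ew /= cats0.
have [||||j] := @polygon_coset D (rcons ws (word_inv c)) i k s hD _ _ _ _ ss.
- move=> j; rewrite size_rcons ltnS leq_eqVlt nth_rcons.
  case: ltnP => [lt _|_ /predU1P[->|//]]; first exact: gws.
  by rewrite eqxx; exact: geodesic_inv.
- by rewrite eP word_val_cat word_val_inv ec mulgV.
- by rewrite size_rcons.
- by rewrite eP onth_cat kw.
rewrite eP => -[jk Hj]; rewrite (vert_catl _ (ltnW kw)).
have [Hw|[wj Hc]] := H_at_cat Hj.
  by rewrite (vert_catl _ (ltnW (H_at_lt Hw))) => kj; left; exists j.
have lt := H_at_lt Hc; rewrite size_word_inv in lt.
rewrite -{1}(subnKC wj) vert_catr vert_inv ?(ltnW lt) //.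
rewrite -ec mulVKg => kj; right.
have Ht := H_at_inv Hc.
exists (size c - (j - size w).+1) => //.
apply: coset_trans kj (coset_sym _); have := H_at_vert Ht.
by rewrite (_ : (size c - (j - size w).+1).+1 = size c - (j - size w)) //; lia.
Qed.

End RelativeMetric.

(** * Words built from long letters are geodesic *)

Section AdmissibleWords.

Local Open Scope nat_scope.
Local Open Scope group_scope.
Set Implicit Arguments.
Unset Strict Implicit.
Unset Printing Implicit Defensive.

Context (G : groupType) (I : Type).
Context (X : invgClosed G) (H : I -> groupClosed G).
Context (R : realType) (D : R) (hD : polygon_constant X H D).

Local Notation letter := (letter X H).
Local Notation word := (word X H).
Local Notation dhat_long := (@dhat_long G I X H R D).
Implicit Types (a b c : letter) (u v w y z : word) (i : I) (g h : G).

Lemma geodesic_nil : geodesic_word ([::] : word).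
Proof. by apply/geodesic_wordP. Qed.

Lemma geodesic1 a : letter_val a <> 1 -> geodesic_word [:: a].
Proof.
move=> a1; apply/geodesic_wordP => -[|//]; rewrite word_val1 word_val_nil => e.
by case: a1.
Qed.

Lemma dhat_long_inv i h : h \in H i -> dhat_long i h -> dhat_long i h^-1.
Proof.
move=> Hh [h1 dh]; split; last by rewrite dhat_inv.
by move=> e; apply: h1; rewrite -(invgK h) e invg1.
Qed.

Lemma geodesic_shortest w (c : word) :
  geodesic_word c -> word_val c = word_val w -> size w <= size c ->
  geodesic_word w.
Proof.
move=> /geodesic_wordP gc e le; apply/geodesic_wordP => w' e'.
by apply: leq_trans le (gc _ _); rewrite e'.
Qed.

(** In a triangle with sides s, b and at most one letter d, the long edge s must
   share its coset with b or with d; either way b lies in H_i. *)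
Lemma geodesic_pair i s b : dhat_long i (val s) -> letter_val b \notin H i ->
  geodesic_word [:: @Hletter G I X H i s; b].
Proof.
set a := Hletter X s => ss bH; set w := [:: a; b].
have s1 : letter_val a <> 1 by case: ss.
have b1 : letter_val b <> 1 by move=> e; rewrite e gpred1 in bH.
have [c [gc ec _]] := geodesic_representative w.
apply: (geodesic_shortest gc ec); rewrite ltnNge; apply/negP => c1.
have [|||||] := @polygon_coset_opposite _ _ X H R D [:: [:: a]; [:: b]] w c i 0 s hD
  _ _ _ gc ec _ ss => //.
- by case=> [|[|//]] _; apply: geodesic1.
- move=> [[|[|j]] [// _ [t e] _]]; last by case: j e.
  by case: e bH => ->; rewrite /= (valP t).
move=> [t [d e] _].
have {e} ec' : c = [:: Hletter X d].
  by case: (c) c1 t e => [|c0 [|//]] _ [|[|t]] // [->].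
move: ec bH; rewrite ec' word_val1 /w word_val_cons word_val1 /= => e.
have -> : letter_val b = (sval s)^-1 * sval d by rewrite e mulKg.
by rewrite gpredM ?gpredV ?(valP d) ?(valP s).
Qed.

Lemma geodesic_pair_sym i s b : dhat_long i (val s) -> letter_val b \notin H i ->
  geodesic_word [:: b; @Hletter G I X H i s].
Proof.
move=> ss bH; rewrite -(word_invK [:: b; _]); apply: geodesic_inv.
apply: geodesic_pair; first exact: (dhat_long_inv (valP s) ss).
by rewrite letter_val_inv gpredV.
Qed.

(** The long edge shares its coset with the t-th edge of a geodesic c joining the
   ends of the word. That the word without its last letter is geodesic gives
   j + 1 <= t, and that the word without its first letter is geodesic bounds
   below what remains of c after the edge. *)
Lemma geodesic_interior_edge a v b i j s :
  geodesic_word (a :: v) -> geodesic_word (rcons v b) ->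
  onth v j = Some (@Hletter G I X H i s) -> dhat_long i (val s) ->
  geodesic_word (a :: rcons v b).
Proof.
move=> gav gvb vj ss; set w := a :: rcons v b.
have jv : j < size v by rewrite -onthTE vj.
have wE : w = (a :: v) ++ [:: b] by rewrite /w -cats1.
have wE' : w = [:: a] ++ rcons v b by [].
have Hj : onth w j.+1 = Some (Hletter X s) by rewrite wE onth_cat /= ltnS jv.
have sw : size w = (size v).+2 by rewrite /w /= size_rcons.
have [c [gc ec _]] := geodesic_representative w.
apply: (geodesic_shortest gc ec).
have [|||||] := @polygon_coset_opposite _ _ X H R D [:: a :: v; [:: b]] w c i j.+1 s hD
  _ _ _ gc ec _ ss => //.
- case=> [|[|//]] _ //=; apply: (@geodesic_infix _ _ _ _ v _ [::]).
  by rewrite cats0 cats1.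
- move=> [j' [ne Hj' co]]; exfalso.
  have Hjw : H_at i w j.+1 by exists s.
  have lt := H_at_lt Hj'; rewrite sw in lt.
  have [jv'|vj'] := leqP j' (size v).
    apply: ne; apply/esym/(geodesic_coset_once (i := i) gav).
    + by exists s; move: Hj; rewrite wE onth_cat /= ltnS jv.
    + by case: Hj' => d; rewrite wE onth_cat /= ltnS jv' => e; exists d.
    + by move: co; rewrite wE !vert_catl //=; lia.
  case: j' ne Hj' co lt vj' => [//|j'] ne [d e] co lt vj'; apply: ne; congr _.+1.
  apply/esym/(geodesic_coset_once (i := i) gvb).
  + by exists s.
  + by exists d.
  + move: co; rewrite wE' -(add1n j) -(add1n j') !(vert_catr [:: a]).
    by move/coset_mull.
move=> [t Ht co].
have Hjw : H_at i w j.+1 by exists s.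
have lo : j.+2 <= 0 + (t + 1).
  apply: (@geodesic_vert _ _ _ _ (a :: v)) => //.
  rewrite vert0 -(@vert_catl _ _ _ _ (a :: v) [:: b]) // -wE.
  apply: (@within_dist_trans _ _ _ _ _ _ _ (vert c t)).
    by have := within_dist_vert c (leq0n t); rewrite vert0 subn0.
  apply: (@within_dist_H _ _ _ _ i); apply: coset_trans (coset_sym co) _.
  exact: H_at_vert.
have up : size (rcons v b) <= j + (1 + (size c - t.+1)).
  apply: (@geodesic_vert _ _ _ _ (rcons v b)) => //.
  apply/(@within_dist_mull _ _ _ _ (word_val [:: a])).
  rewrite -!vert_catr -wE'.
  have -> : size [:: a] + size (rcons v b) = size w by rewrite wE' size_cat.
  rewrite vert_size -ec -vert_size.
  apply: within_dist_trans (within_dist_vert c (H_at_lt Ht)).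
  apply: (@within_dist_H _ _ _ _ i); apply: coset_trans co _.
  exact: H_at_vert.
have := H_at_lt Ht; move: up; rewrite size_rcons sw; lia.
Qed.

Context (i1 i2 : I) (hi : i1 <> i2).

(** Letters a_ij, b_ij and x_i. The admissible pairs are the successions of
   letters in a cyclic shift of a relator itself; cyclic shifts of its inverse
   are reached through [geodesic_inv]. *)
Definition long_letter i a : Prop := exists s, [/\ a = @Hletter G I X H i s,
  dhat_long i (val s) & ~~ ((val s \in H i1) && (val s \in H i2))].

Definition turning_letter a : Prop := exists2 x, a = Xletter H x &
  forall h1 h2, h1 \in H i1 -> h2 \in H i2 -> val x <> h2 * h1.

Inductive admissible_pair a b : Prop :=
  | Pair12 of long_letter i1 a & long_letter i2 b
  | Pair21 of long_letter i2 a & long_letter i1 b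
  | PairX1 of turning_letter a & long_letter i1 b
  | Pair2X of long_letter i2 a & turning_letter b.

Definition admissible w : Prop :=
  (forall j a, onth w j = Some a ->
     [\/ long_letter i1 a, long_letter i2 a | turning_letter a]) /\
  (forall j a b, onth w j = Some a -> onth w j.+1 = Some b ->
     admissible_pair a b).

Lemma admissible_infix u v w : admissible (u ++ v ++ w) -> admissible v.
Proof.
have sub j a : onth v j = Some a -> onth (u ++ v ++ w) (size u + j) = Some a.
  move=> e; rewrite !onth_cat ltnNge leq_addr addKn /= ifT //.
  by rewrite -onthTE e.
move=> [l p]; split=> [j a /sub/l //|j a b /sub ea /sub]; rewrite addnS.
exact: p.
Qed.

Lemma long_letter_neq1 i a : long_letter i a -> letter_val a <> 1.
Proof. by move=> [s [-> [s1 _] _]]. Qed.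

Lemma long_not_turning i a : turning_letter a -> long_letter i a -> False.
Proof. by move=> [x -> _] [s []]. Qed.

Lemma turning_letter_notin a : turning_letter a ->
  letter_val a \notin H i1 /\ letter_val a \notin H i2.
Proof.
move=> [x -> hx] /=; split; apply/negP => xH.
  by apply: (hx (val x) 1) => //; rewrite ?gpred1 ?mul1g.
by apply: (hx 1 (val x)) => //; rewrite ?gpred1 ?mulg1.
Qed.

Lemma geodesic_admissible_pair a b : admissible_pair a b -> geodesic_word [:: a; b].
Proof.
case=> [[s [-> ss sZ]] [t [-> ts tZ]]|[s [-> ss sZ]] [t [-> ts tZ]]| |].
- apply: geodesic_pair => //; apply: contra tZ => /= ->.
  by rewrite (valP t).
- apply: geodesic_pair => //; apply: contra tZ => /= ->.
  by rewrite (valP t).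
- move=> /turning_letter_notin[a1 _] [s [-> ss _]]; exact: geodesic_pair_sym.
- move=> [s [-> ss _]] /turning_letter_notin[_ b2]; exact: geodesic_pair.
Qed.

(** If d has at most two letters and the same value as a b c, then d contains an
   H_2-edge in the coset of a and an H_1-edge in the coset of c. In either order,
   b is a product of an element of H_2 by an element of H_1. *)
Lemma geodesic_turn a b c :
  long_letter i2 a -> turning_letter b -> long_letter i1 c ->
  geodesic_word [:: a; b; c].
Proof.
move=> La Tb Lc; have [b1 b2] := turning_letter_notin Tb.
case: La => s [ea ss _]; case: Lc => r [ec rs _]; case: Tb => x eb hx.
set w := [:: a; b; c].
have gs j : j < size [:: [:: a]; [:: b]; [:: c]] ->
    geodesic_word (nth [::] [:: [:: a]; [:: b]; [:: c]] j).
  case: j => [|[|[|//]]] _; apply: geodesic1.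
  - by rewrite ea; case: ss.
  - by move=> e; rewrite e gpred1 in b1.
  - by rewrite ec; case: rs.
have [d [gd ed _]] := geodesic_representative w.
apply: (geodesic_shortest gd ed); rewrite leqNgt; apply/negP => d3.
have [t Ht ct] : exists2 t, H_at i2 d t & same_coset H i2 1 (vert d t).
  have [||||] := @polygon_coset_opposite _ _ X H R D _ w d i2 0 s hD
    _ gs _ gd ed _ ss => //.
  - by rewrite /w ea.
  - move=> [j [ne Hj _]]; exfalso.
    case: j ne Hj => [//|[|[|j]]] _ [k]; rewrite /= ?eb ?ec //.
      by case=> e; case: hi.
    by case: j.
  by move=> [t Ht co]; exists t; rewrite // -(vert0 w).
have [t' Ht' ct'] : exists2 t, H_at i1 d t &
    same_coset H i1 (letter_val a * letter_val b) (vert d t).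
  have [||||] := @polygon_coset_opposite _ _ X H R D _ w d i1 2 r hD
    _ gs _ gd ed _ rs => //.
  - by rewrite /w ec.
  - move=> [j [ne Hj _]]; exfalso.
    case: j ne Hj => [|[|[//|j]]] _ [k]; rewrite /= ?ea ?eb //.
      by case=> e; case: hi.
    by case: j.
  move=> [t' Ht' co]; exists t' => //.
  by move: co; rewrite /vert /w /= word_val_cons word_val1.
have ne : t <> t' by move=> e; case: hi; apply: H_at_uniq Ht' _; rewrite -e.
have t_lt := H_at_lt Ht; have t'_lt := H_at_lt Ht'; rewrite /= in d3.
have xE : letter_val b = val x by rewrite eb.
have aH : letter_val a \in H i2 by rewrite ea (valP s).
have [[t0 t'1]|[t1 t'0]] : ((t = 0) /\ (t' = 1%N)) \/ ((t = 1%N) /\ (t' = 0)) by lia.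
  have := H_at_vert Ht; rewrite t0 vert0 /same_coset invg1 mul1g => d0.
  have h1H := coset_sym ct'; rewrite t'1 /same_coset in h1H.
  apply: (hx _ ((letter_val a)^-1 * vert d 1%N) h1H).
    by rewrite gpredM // gpredV.
  by rewrite xE -mulgA mulVKg mulKg.
have h1H := coset_sym ct'; rewrite t'0 vert0 /same_coset invg1 mul1g in h1H.
apply: (hx _ (letter_val a)^-1 h1H); first by rewrite gpredV.
by rewrite xE mulKg.
Qed.

(** A turning letter has long neighbors, so a word of length at least four has a
   long letter in its second or third place, and an admissible word of length
   three without a long letter in the middle is of the form b x a. *)
Lemma admissible_geodesic w : admissible w -> geodesic_word w.
Proof.
have [n] := ubnP (size w); elim: n w => // n IH [|a w] wn adm.
  exact: geodesic_nil.
case/lastP: w wn adm => [|v b] wn adm.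
  apply: geodesic1; have [/long_letter_neq1 //|/long_letter_neq1 //|] := adm.1 0 a erefl.
  by move=> /turning_letter_notin[a1 _] e; rewrite e gpred1 in a1.
rewrite /= size_rcons in wn.
have gav : geodesic_word (a :: v).
  apply: IH; first by rewrite /=; lia.
  by apply: (@admissible_infix [::] _ [:: b]); rewrite /= cats1.
have gvb : geodesic_word (rcons v b).
  apply: IH; first by rewrite size_rcons; lia.
  by apply: (@admissible_infix [:: a] _ [::]); rewrite cats0.
case: v adm gav gvb {wn} => [|c v] adm gav gvb.
  exact: geodesic_admissible_pair (adm.2 0 a b erefl erefl).
have long i j d : onth (c :: v) j = Some d -> long_letter i d ->
    geodesic_word (a :: rcons (c :: v) b).
  move=> e [s [ed ss _]]; rewrite ed in e.
  exact: geodesic_interior_edge gav gvb e ss.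
have [|lc|lc|turn] := adm.1 1%N c; [by [] | exact: (long _ 0) lc | exact: (long _ 0) lc | ].
have := adm.2 0 a c erefl erefl.
case: v adm gav gvb long => [|d v] adm gav gvb long.
  have cb := adm.2 1%N c b erefl erefl.
  case=> [_ /(long_not_turning turn)|_ /(long_not_turning turn)|_|La _] //.
    by move/(long_not_turning turn).
  case: cb => [/(long_not_turning turn)|/(long_not_turning turn)|_ Lb|] //.
    exact: geodesic_turn.
  by move/(long_not_turning turn).
move=> _; case: (adm.2 1%N c d erefl erefl).
- by move/(long_not_turning turn).
- by move/(long_not_turning turn).
- by move=> _ Ld; apply: (long _ 1%N) Ld.
- by move/(long_not_turning turn).
Qed.

End AdmissibleWords.

(** * Geodesics with nearby endpoints *)

Section ParallelEdges.

Local Open Scope nat_scope.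
Local Open Scope group_scope.
Set Implicit Arguments.
Unset Strict Implicit.
Unset Printing Implicit Defensive.

Context (G : groupType) (I : Type).
Context (X : invgClosed G) (H : I -> groupClosed G).
Context (R : realType) (D : R) (hD : polygon_constant X H D).

Local Notation word := (word X H).
Local Notation dhat_long := (@dhat_long G I X H R D).

Context (E : nat) (u u' y z : word).
Context (gu : geodesic_word u) (gu' : geodesic_word u').
Context (yE : size y <= E) (zE : size z <= E).
Context (yuz : word_val u' = word_val (y ++ u ++ z)).

Definition parallel i s t : Prop :=
  [/\ H_at i u s, H_at i u' t
    & same_coset H i (word_val y * vert u s) (vert u' t)].

(** A companion of the s-th edge on y or on z would bring that edge within
   E + 1 of an end of u. *)
Lemma parallel_exists i s h : E.+2 <= s -> s + E.+2 <= size u ->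
  onth u s = Some (@Hletter G I X H i h) -> dhat_long i (val h) ->
  exists t, parallel i s t.
Proof.
move=> Es sE us lh.
have [y0 [gy ey sy]] := geodesic_representative y.
have [z0 [gz ez sz]] := geodesic_representative z.
have us' : H_at i u s by exists h.
have ss := H_at_lt us'.
have [||||||] := @polygon_coset_opposite _ _ X H R D [:: y0; u; z0] (y0 ++ u ++ z0)
  u' i (size y0 + s) h hD _ _ _ gu' _ _ lh => //.
- by rewrite /= cats0.
- by case=> [|[|[|//]]].
- by rewrite yuz !word_val_cat ey ez.
- by rewrite !onth_cat ltnNge leq_addr addKn /= ss.
- rewrite vert_catr (vert_catl _ (ltnW ss)) => -[j [ne Hj co]]; exfalso.
  have [Hy|[yj Huz]] := H_at_cat Hj.
    have jy := ltnW (H_at_lt Hy); rewrite (vert_catl _ jy) in co.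
    suff : s <= 0 + (size y0 - j + 1) by lia.
    apply: (geodesic_vert gu (ltnW ss)); rewrite vert0.
    apply/(within_dist_mull _ _ (word_val y0)); rewrite mulg1.
    apply: (within_dist_trans (h := vert y0 j)); last exact: within_dist_H (coset_sym co).
    by apply: within_dist_sym; rewrite -vert_size; apply: within_dist_vert.
  rewrite -{1}(subnKC yj) vert_catr coset_mull in co.
  have [Hu|[uj Hz]] := H_at_cat Huz.
    rewrite (vert_catl _ (ltnW (H_at_lt Hu))) in co.
    have := geodesic_coset_once gu us' Hu co; lia.
  have jz := H_at_lt Hz.
  rewrite -{1}(subnKC uj) vert_catr in co.
  set r := (j - size y0 - size u)%N in jz co.
  suff : size u <= s + (1 + r) by lia.
  apply: (geodesic_vert gu (leqnn _)); rewrite vert_size.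
  apply: (within_dist_trans (within_dist_H X co)); apply: within_dist_sym.
  rewrite -{1}(mulg1 (word_val u)) within_dist_mull -(vert0 z0) -{1}(subn0 r).
  exact: within_dist_vert.
by rewrite vert_catr (vert_catl _ (ltnW ss)) ey => -[t Ht co]; exists t.
Qed.

Lemma within_dist_y_vert s : within_dist X H (E + s) 1 (word_val y * vert u s).
Proof.
apply: within_dist_trans (_ : within_dist X H E 1 (word_val y)) _.
  by exists y; rewrite mul1g.
rewrite -{1}(mulg1 (word_val y)) within_dist_mull -(vert0 u) -{1}(subn0 s).
exact: within_dist_vert.
Qed.

Lemma parallel_bounds i s t : parallel i s t ->
  (t <= s + E.+1) && (s <= t + E.+1).
Proof.
move=> [us ut co]; apply/andP; split.
  suff : t <= 0 + (E + s + 1) by lia.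
  apply: (geodesic_vert gu' (ltnW (H_at_lt ut))); rewrite vert0.
  exact: within_dist_trans (within_dist_y_vert s) (within_dist_H X co).
suff : s <= 0 + (E + t + 1) by lia.
apply: (geodesic_vert gu (ltnW (H_at_lt us))); rewrite vert0.
apply/(within_dist_mull _ _ (word_val y)); rewrite mulg1.
apply: within_dist_trans (within_dist_H X (coset_sym co)).
apply: (within_dist_trans (h := 1)).
  by apply: within_dist_sym; exists y; rewrite mul1g.
by rewrite -{1}(vert0 u') -{1}(subn0 t); apply: within_dist_vert.
Qed.

Lemma parallel_next_coset i s t : parallel i s t ->
  same_coset H i (word_val y * vert u s.+1) (vert u' t).
Proof.
move=> [us ut co]; apply: coset_trans co; apply/coset_mull.
exact/coset_sym/H_at_vert.
Qed.

Lemma consecutive_types i i' s : H_at i u s -> H_at i' u s.+1 -> i <> i'.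
Proof.
move=> us us' e; rewrite -e in us'.
by have := geodesic_coset_once gu us us' (H_at_vert us); lia.
Qed.

(** Two consecutive edges of u lie in two cosets with a common vertex, so the
   corresponding edges of the geodesic u' span at most two edges. *)
Lemma parallel_step i i' s t t' : parallel i s t -> parallel i' s.+1 t' ->
  t' = t.+1 \/ t = t'.+1.
Proof.
move=> P1 P2; have co1 := parallel_next_coset P1.
have [us ut _] := P1; have [us' ut' co2] := P2.
have ne : t <> t'.
  by move=> e; apply: (consecutive_types us us'); apply: H_at_uniq ut _; rewrite e.
have le1 : t'.+1 <= t + (1 + 1).
  apply: (geodesic_vert gu' (H_at_lt ut')).
  apply: within_dist_trans (within_dist_H X (coset_sym co1)) (within_dist_H X _).
  exact: coset_trans co2 (H_at_vert ut').
have le2 : t.+1 <= t' + (1 + 1).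
  apply: (geodesic_vert gu' (H_at_lt ut)).
  apply: within_dist_trans (within_dist_H X (coset_sym co2)) (within_dist_H X _).
  exact: coset_trans co1 (H_at_vert ut).
lia.
Qed.

Lemma parallel_inj i i' s s' t : parallel i s t -> parallel i' s' t -> s = s'.
Proof.
move=> [us ut co] [us' ut' co']; have e := H_at_uniq ut ut'; subst i'.
apply: (geodesic_coset_once gu us us'); apply/(coset_mull _ _ (word_val y)).
exact: coset_trans co (coset_sym co').
Qed.

(** The companions move along u' by one step at a time without ever turning
   back. If the motion were decreasing, E + 2 steps would take the companion too
   far from the position that [parallel_bounds] allows. *)
Lemma parallel_run s0 : E.+2 <= s0 -> s0 + E.*2 + 4 <= size u ->
  (forall s, s0 <= s <= s0 + E.+2 -> exists i h,
     onth u s = Some (@Hletter G I X H i h) /\ dhat_long i (val h)) ->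
  exists s t i i' i'', [/\ i <> i' /\ i' <> i'', s0 <= s <= s0 + E.+2,
    parallel i s t, parallel i' s.+1 t.+1 & parallel i'' s.+2 t.+2].
Proof.
move=> Es0 s0u win.
have par s : s0 <= s <= s0 + E.+2 -> exists i t, parallel i s t.
  move=> sw; have [i [h [us lh]]] := win s sw.
  by have [||t P] := parallel_exists _ _ us lh; [lia|lia|exists i, t].
apply: contrapT => nex.
have [i0 [t0 P0]] : exists i t, parallel i s0 t by apply: par; lia.
have [i1 [t1 P1]] : exists i t, parallel i s0.+1 t by apply: par; lia.
have [up|down] := parallel_step P0 P1.
  have [i2 [t2 P2]] : exists i t, parallel i s0.+2 t by apply: par; lia.
  apply: nex; exists s0, t0, i0, i1, i2.
  have [us0 _ _] := P0; have [us1 _ _] := P1; have [us2 _ _] := P2.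
  have [e|e] := parallel_step P1 P2.
    split; rewrite -?up -?e //; last by lia.
    by split; [exact: consecutive_types us0 us1 | exact: consecutive_types us1 us2].
  have et : t2 = t0 by lia.
  by rewrite et in P2; have := parallel_inj P0 P2; lia.
have desc n : n <= E.+1 -> exists i i' t,
    [/\ parallel i (s0 + n) t.+1, parallel i' (s0 + n).+1 t & t + n.+1 = t0].
  elim: n => [_|n IH nE].
    by exists i0, i1, t1; rewrite addn0 -down addn1; split.
  have [|i [i' [t [P P' et]]]] := IH; first lia.
  have [i'' [t'' P'']] : exists i t, parallel i (s0 + n).+2 t by apply: par; lia.
  have [e|e] := parallel_step P' P''.
    rewrite e in P''; have := parallel_inj P P''; lia.
  exists i', i'', t''; rewrite addnS -e; split=> //; lia.
have [i [i' [t [_ P' et]]]] := desc E.+1 (leqnn _).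
have := parallel_bounds P'; have := parallel_bounds P0; lia.
Qed.

End ParallelEdges.

(** * Rotations of sequences without repetition *)

Section Rotations.

Local Open Scope nat_scope.
Set Implicit Arguments.
Unset Strict Implicit.
Unset Printing Implicit Defensive.

Lemma rot_rot_lt (T : Type) (s : seq T) j n :
  0 < size s -> exists2 k, k < size s & rot j (rot n s) = rot k s.
Proof.
move=> s0.
have red l (t : seq T) : size t = size s -> exists2 k, k < size s & rot l t = rot k t.
  move=> st; have [lt|le] := ltnP l (size s); first by exists l.
  by exists 0 => //; rewrite rot0 rot_oversize // st.
have [n' n'lt ->] := red n s erefl.
have [j' j'lt ->] := red j (rot n' s) (size_rot _ _).
by rewrite rot_add_mod ?(ltnW n'lt) ?(ltnW j'lt) //; exact: red.
Qed.

Lemma rot_rot_ex (T : Type) (s : seq T) j n :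
  exists k, rot j (rot n s) = rot k s.
Proof.
case: s => [|t s]; first by exists 0.
by have [|k _ e] := @rot_rot_lt _ (t :: s) j n; last exists k.
Qed.

(** A rotation of a sequence without repetition is determined by its head. *)
Lemma rot_uniq_head (T : eqType) (s : seq T) n j q : uniq s ->
  onth (rot n s) j = Some q -> rot j (rot n s) = rot (index q s) s.
Proof.
move=> us e.
have jn : j < size s by rewrite -(size_rot n s) -onthTE e.
have [|k ks eq] := @rot_rot_lt _ s j n; first by lia.
have hd : nth q (rot j (rot n s)) 0 = q.
  by rewrite /rot nth_cat size_drop subn_gt0 !size_rot jn nth_drop addn0 (@onth_nth _ q _ _ _ e).
rewrite eq /rot nth_cat size_drop subn_gt0 ks nth_drop addn0 in hd.
have <- : k = index q s by rewrite -[in RHS]hd index_uniq.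
exact: eq.
Qed.

Lemma nth_rot_iota n N j : n <= N -> j < N ->
  nth 0 (rot n (iota 0 N)) j = if n + j < N then n + j else n + j - N.
Proof.
move=> nN jN; rewrite /rot drop_iota take_iota (minn_idPl nN) nth_cat size_iota.
by rewrite add0n; case: ifP => ?; rewrite nth_iota; try lia; case: ifP; lia.
Qed.

Lemma nth_flatten_pairs (S T : Type) (f g : S -> T) (s : seq S) (x0 : T) y0 j :
  j < size s ->
  nth x0 (flatten [seq [:: f i; g i] | i <- s]) j.*2 = f (nth y0 s j) /\
  nth x0 (flatten [seq [:: f i; g i] | i <- s]) j.*2.+1 = g (nth y0 s j).
Proof. by elim: s j => // c s IH [|j] //= /IH. Qed.

Lemma size_flatten_pairs (S T : Type) (f g : S -> T) (s : seq S) :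
  size (flatten [seq [:: f i; g i] | i <- s]) = (size s).*2.
Proof. by elim: s => //= c s ->. Qed.

End Rotations.

(** * The relators and their pieces *)

Section Relators.

Local Open Scope nat_scope.
Local Open Scope group_scope.
Set Implicit Arguments.
Unset Strict Implicit.
Unset Printing Implicit Defensive.

Context (R : realType) (G : groupType) (I : Type).
Context (H : I -> groupClosed G) (X : invgClosed G).
Context (i1 i2 : I) (hi : i1 <> i2).
Context (D : R) (hD : polygon_constant X H D).
Context (K : Type) (x : K -> {x : G | x \in X}).
Context (hx : forall k : K,
  ~ [set (h2 * h1) | h2 in [set` H i2] & h1 in [set` H i1]] (val (x k))).
Context (hcent : [set` H i1] `&` [set` H i2] `<=`
  centralizer [set` H i1] `&` centralizer [set` H i2] `&`
    \bigcap_(k in [set: K]) centralizer [set val (x k)]).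
Context (m : nat).
Context (a : K -> 'I_m -> {h : G | h \in H i1}).
Context (b : K -> 'I_m -> {h : G | h \in H i2}).
Context (ha : forall (i : K) (j : 'I_m),
  ((50 * D)%R%:E <= Order.min (dhat X H i1 1%g (val (a i j)))
                            (dhat X H i2 (val (b i j)) 1%g))%E).
Context (hb : forall (i k : K) (j l : 'I_m) (gamma : bool),
  ([set` H i1] `&` [set` H i2]) (val (a k l) * sgnpow (val (a i j)) gamma) \/
  ([set` H i1] `&` [set` H i2]) (val (b k l) * sgnpow (val (b i j)) gamma) ->
  [/\ i = k, j = l & gamma = true]).

Local Notation letter := (letter X H).
Local Notation word := (word X H).
Implicit Types (u v w y z r : word) (i : I) (g h : G) (k : K) (c : bool).

Definition core g : bool := (g \in H i1) && (g \in H i2).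

Lemma core_set g : core g -> ([set` H i1] `&` [set` H i2]) g.
Proof. by move=> /andP[]. Qed.

Lemma coreM g h : core g -> core h -> core (g * h).
Proof. by move=> /andP[? ?] /andP[? ?]; rewrite /core !gpredM. Qed.

Lemma coreV g : core g^-1 = core g.
Proof. by rewrite /core !gpredV. Qed.

Lemma core_of i i' g : i <> i' -> i = i1 \/ i = i2 -> i' = i1 \/ i' = i2 ->
  g \in H i -> g \in H i' -> core g.
Proof. by rewrite /core => ne [] e [] e'; subst => // -> ->. Qed.

Lemma core_commute1 g h : core g -> h \in H i1 -> commute g h.
Proof. by move=> /core_set/hcent[[+ _] _]; apply. Qed.

Lemma core_commute2 g h : core g -> h \in H i2 -> commute g h.
Proof. by move=> /core_set/hcent[[_ +] _]; apply. Qed.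

Lemma core_commute_x g k : core g -> commute g (val (x k)).
Proof. by move=> /core_set/hcent[_ /(_ k Logic.I)]; apply. Qed.

Local Notation N := (m.*2.+1).

(** A cyclic shift of a relator or of its inverse is stored as the list of the
   positions of its letters in the relator, with a sign c common to all of them:
   statements about single occurrences of letters become statements about
   sequences of numbers without repetition. *)
Definition ltr k c p : letter :=
  let l := nth (Xletter H (x k)) (relator (x k) (a k) (b k)) p in
  if c then letter_inv l else l.

Arguments ltr : simpl never.

Definition indices c n : seq nat :=
  rot n (if c then rev (iota 0 N) else iota 0 N).

Definition cyclic_relator k c n : word := map (ltr k c) (indices c n).

Lemma size_indices c n : size (indices c n) = N.
Proof. by rewrite size_rot; case: c; rewrite ?size_rev size_iota. Qed.

Lemma size_cyclic_relator k c n : size (cyclic_relator k c n) = N.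
Proof. by rewrite size_map size_indices. Qed.

Lemma uniq_indices c n : uniq (indices c n).
Proof. by rewrite rot_uniq; case: c; rewrite ?rev_uniq iota_uniq. Qed.

Lemma onth_indices c n j p : onth (indices c n) j = Some p -> p < N.
Proof.
move=> e; have : p \in indices c n by apply/onthP; exists j.
by rewrite mem_rot; case: c {e}; rewrite ?mem_rev mem_iota.
Qed.

Lemma relatorE k : relator (x k) (a k) (b k) = cyclic_relator k false 0.
Proof.
rewrite /cyclic_relator /indices rot0 -[LHS](mkseq_nth (Xletter H (x k))) /mkseq.
by rewrite /= size_flatten_pairs size_enum_ord.
Qed.

Lemma rot_cyclic_relator j k c n :
  exists n', rot j (cyclic_relator k c n) = cyclic_relator k c n'.
Proof.
rewrite /cyclic_relator -map_rot /indices.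
have [n' ->] := rot_rot_ex (if c then rev (iota 0 N) else iota 0 N) j n.
by exists n'.
Qed.

Lemma inv_cyclic_relator k c n :
  exists n', word_inv (cyclic_relator k c n) = cyclic_relator k (~~ c) n'.
Proof.
rewrite /cyclic_relator /word_inv -map_comp -map_rev rev_rot /rotr.
exists (size (rev (if c then rev (iota 0 N) else iota 0 N)) - n)%N.
rewrite /indices; case: c => /=; rewrite ?revK; apply: eq_map => p /=.
  by rewrite /ltr letter_invK.
by [].
Qed.

Lemma symmetrization_cyclic r :
  symmetrization [set relator (x i) (a i) (b i) | i in [set: K]] r ->
  exists k c n, r = cyclic_relator k c n.
Proof.
move=> /(_ [set w | exists k c n, w = cyclic_relator k c n]); apply.
split=> [w n [k [c [n' ->]]]|_ [k _ <-]]; last first.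
  by exists k, false, 0; rewrite relatorE.
split; first by have [l ->] := rot_cyclic_relator n k c n'; exists k, c, l.
have [l ->] := inv_cyclic_relator k c n'.
by have [l' ->] := rot_cyclic_relator n k (~~ c) l; exists k, (~~ c), l'.
Qed.

Lemma index_cases p : p < N ->
  [\/ p = 0, exists j : 'I_m, p = j.*2.+1 | exists j : 'I_m, p = j.*2.+2].
Proof.
case: p => [|p] pN; first by constructor.
have jm : p./2 < m by lia.
by have [o|e] := boolP (odd p); [constructor 3|constructor 2];
  exists (Ordinal jm) => /=; lia.
Qed.

Lemma ltr_a k c (j : 'I_m) :
  exists2 s, ltr k c j.*2.+1 = @Hletter G I X H i1 s &
             val s = sgnpow (val (a k j)) c.
Proof.
rewrite /ltr /=; have [|-> _] := nth_flatten_pairs (fun j => Hletter X (a k j))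
  (fun j => Hletter X (b k j)) (s := enum 'I_m) (Xletter H (x k)) j (j := j).
  by rewrite size_enum_ord.
rewrite nth_ord_enum; case: c => /=; last by exists (a k j).
by exists (exist (fun h => h \in H i1) _ (Hinv_subproof (a k j))).
Qed.

Lemma ltr_b k c (j : 'I_m) :
  exists2 s, ltr k c j.*2.+2 = @Hletter G I X H i2 s &
             val s = sgnpow (val (b k j)) c.
Proof.
rewrite /ltr /=; have [|_ ->] := nth_flatten_pairs (fun j => Hletter X (a k j))
  (fun j => Hletter X (b k j)) (s := enum 'I_m) (Xletter H (x k)) j (j := j).
  by rewrite size_enum_ord.
rewrite nth_ord_enum; case: c => /=; last by exists (b k j).
by exists (exist (fun h => h \in H i2) _ (Hinv_subproof (b k j))).
Qed.

Lemma ltr_x k c : exists2 s, ltr k c 0 = Xletter H s & val s = sgnpow (val (x k)) c.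
Proof.
case: c => /=; last by exists (x k).
by exists (exist (fun h => h \in X) _ (Xinv_subproof (x k))).
Qed.

Lemma sgnpowP i h c : h \in H i -> sgnpow h c \in H i.
Proof. by case: c => //=; rewrite gpredV. Qed.

Lemma a_notin_core k j : ~~ core (val (a k j)).
Proof.
apply/negP => /[dup] c1 /(coreM c1) c2.
by have [] := hb (i := k) (k := k) (j := j) (l := j) (gamma := false) (or_introl (core_set c2)).
Qed.

Lemma b_notin_core k j : ~~ core (val (b k j)).
Proof.
apply/negP => /[dup] c1 /(coreM c1) c2.
by have [] := hb (i := k) (k := k) (j := j) (l := j) (gamma := false) (or_intror (core_set c2)).
Qed.

Lemma not_core_neq1 g : ~~ core g -> g <> 1.
Proof. by move=> + e; rewrite e /core !gpred1. Qed.

Lemma ltr_a_long k c (j : 'I_m) : long_letter D i1 i2 i1 (ltr k c j.*2.+1).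
Proof.
have [s -> es] := ltr_a k c j; have /negP nc := a_notin_core k j.
have lo : dhat_long X H D i1 (val (a k j)).
  split; first exact/not_core_neq1/negP.
  by have := ha k j; rewrite le_min => /andP[].
exists s; rewrite es; split=> //.
  by case: (c) => //=; apply: dhat_long_inv lo; exact: (valP (a k j)).
by apply/negP => cs; apply: nc; move: cs; rewrite -/(core _); case: (c) => //=; rewrite coreV.
Qed.

Lemma ltr_b_long k c (j : 'I_m) : long_letter D i1 i2 i2 (ltr k c j.*2.+2).
Proof.
have [s -> es] := ltr_b k c j; have /negP nc := b_notin_core k j.
have lo : dhat_long X H D i2 (val (b k j)).
  split; first exact/not_core_neq1/negP.
  by have := ha k j; rewrite le_min => /andP[_]; rewrite dhat_sym.
exists s; rewrite es; split=> //.
  by case: (c) => //=; apply: dhat_long_inv lo; exact: (valP (b k j)).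
by apply/negP => cs; apply: nc; move: cs; rewrite -/(core _); case: (c) => //=; rewrite coreV.
Qed.

Lemma ltr_x_turning k : turning_letter i1 i2 (ltr k false 0).
Proof.
exists (x k) => // h1 h2 H1 H2 e; apply: (hx (k := k)).
by exists h2 => //; exists h1.
Qed.

Lemma ltr_H k c p i s : p < N -> ltr k c p = @Hletter G I X H i s ->
  (exists j : 'I_m, [/\ i = i1, p = j.*2.+1 & val s = sgnpow (val (a k j)) c]) \/
  (exists j : 'I_m, [/\ i = i2, p = j.*2.+2 & val s = sgnpow (val (b k j)) c]).
Proof.
move=> /index_cases[->|[j ->]|[j ->]].
- by have [t -> _] := ltr_x k c.
- have [t -> et] := ltr_a k c j => e; left; exists j.
  have ei : i1 = i by case: e.
  subst i; split=> //; rewrite -et.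
  exact: (congr1 (@letter_val G I X H) (esym e)).
- have [t -> et] := ltr_b k c j => e; right; exists j.
  have ei : i2 = i by case: e.
  subst i; split=> //; rewrite -et.
  exact: (congr1 (@letter_val G I X H) (esym e)).
Qed.

Lemma geodesic_cyclic_relator k c n : geodesic_word (cyclic_relator k c n).
Proof.
suff pos l : geodesic_word (cyclic_relator k false l).
  case: c => //; have [n' e] := inv_cyclic_relator k true n.
  by rewrite -(word_invK (cyclic_relator _ _ _)) e; apply: geodesic_inv.
apply: (admissible_geodesic hD hi).
wlog lN : l / l <= N.
  move=> hw; have [le|lt] := leqP l N; first exact: hw.
  suff -> : cyclic_relator k false l = cyclic_relator k false 0 by exact: hw.
  by rewrite /cyclic_relator /indices rot0 rot_oversize // size_iota ltnW.
split=> [j d|j d d'].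
  rewrite onth_map; case e: onth => [p|] //= [<-].
  have [->|[q ->]|[q ->]] := index_cases (onth_indices e).
  - by constructor 3; exact: ltr_x_turning.
  - by constructor 1; exact: ltr_a_long.
  - by constructor 2; exact: ltr_b_long.
rewrite !onth_map; case e: (onth (indices false l) j) => [p|//] [<-].
case e': (onth (indices false l) j.+1) => [p'|//] [<-].
have jN : j.+1 < N by rewrite -(size_indices false l) -onthTE e'.
have pE := @onth_nth _ 0 _ _ _ e; have p'E := @onth_nth _ 0 _ _ _ e'.
rewrite nth_rot_iota // ?(ltnW jN) // in pE; rewrite nth_rot_iota // in p'E.
have {pE p'E} next : p' = (if p.+1 < N then p.+1 else 0).
  by move: pE p'E; do 3 case: ifP; lia.
have pN := onth_indices e; rewrite next.
have [pq|[q pq]|[q pq]] := index_cases pN; rewrite pq in pN *.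
- have m0 : 0 < m by lia.
  rewrite ifT; last lia.
  by apply: PairX1 (ltr_x_turning k) (ltr_a_long k false (Ordinal m0)).
- rewrite ifT; last by have := ltn_ord q; lia.
  exact: Pair12 (ltr_a_long _ _ _) (ltr_b_long _ _ _).
- case: ifP => lt; last exact: Pair2X (ltr_b_long _ _ _) (ltr_x_turning _).
  have qm : q.+1 < m by lia.
  exact: Pair21 (ltr_b_long _ _ _) (ltr_a_long k false (Ordinal qm)).
Qed.

Lemma core_commute_cyclic g k c n :
  core g -> commute g (word_val (cyclic_relator k c n)).
Proof.
move=> cg; have comm p : p < N -> commute g (letter_val (ltr k c p)).
  move=> /index_cases[->|[j ->]|[j ->]].
  - have [s -> /= ->] := ltr_x k c.
    by case: (c) => /=; [apply: commuteV|]; exact: core_commute_x.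
  - by have [s -> /= _] := ltr_a k c j; apply: core_commute1 (valP s).
  - by have [s -> /= _] := ltr_b k c j; apply: core_commute2 (valP s).
rewrite /word_val /cyclic_relator big_map big_seq.
apply: (@commute_prod _ _ _ _ (fun p => letter_val (ltr k c p))) => p.
by move=> /onthP[j /onth_indices]; exact: comm.
Qed.

(** Condition (b), with signs on both letters. When the second sign is -1, the
   quotient is h'^-1 l^-1 with l the value of the first letter; inverting it and
   conjugating by l, which commutes with [core], gives the product h' l that (b) speaks of. *)
Lemma same_index k c p k' c' p' i (s s' : {h : G | h \in H i}) :
  p < N -> p' < N -> ltr k c p = Hletter X s -> ltr k' c' p' = Hletter X s' ->
  core (val s' * (val s)^-1) -> [/\ k = k', c = c' & p = p'].
Proof.
move=> pN p'N e e' cs.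
have signs h h' : h \in H i -> h' \in H i ->
    val s = sgnpow h c -> val s' = sgnpow h' c' ->
    i = i1 \/ i = i2 ->
    exists2 gamma : bool, core (h' * sgnpow h gamma) & gamma = true -> c = c'.
  move=> hH h'H es es' i12.
  have comm g l : core g -> l \in H i -> commute g l.
    by case: i12 => ->; [exact: core_commute1 | exact: core_commute2].
  rewrite es es' in cs; case: (c') cs => /= cs; last first.
    exists (~~ c); last by case: (c).
    by case: (c) cs => //=; rewrite invgK.
  exists c => //; set l := sgnpow h c in cs *.
  have lH : l \in H i by exact: sgnpowP.
  have cl : core (l * h') by rewrite -coreV invgM.
  have -> // : h' * l = l * h'.
  apply: (mulgI l); rewrite mulgA; exact: comm.
have [[j [ei ep es]]|[j [ei ep es]]] := ltr_H pN e;
  have [[j' [ei' ep' es']]|[j' [ei' ep' es']]] := ltr_H p'N e'.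
- have [|||gamma cg cc] := signs _ _ _ _ es es'; rewrite ?ei ?(valP (a _ _)) //; first by left.
  have [-> jj gt] := hb (or_introl (core_set cg)).
  by rewrite ep ep' jj cc.
- by case: hi; rewrite -ei -ei'.
- by case: hi; rewrite -ei -ei'.
- have [|||gamma cg cc] := signs _ _ _ _ es es'; rewrite ?ei ?(valP (b _ _)) //; first by right.
  have [-> jj gt] := hb (or_intror (core_set cg)).
  by rewrite ep ep' jj cc.
Qed.

(** The run of E + 3 long edges needed by [parallel_run] is looked for among two
   disjoint windows in u: the letter x_k, which occurs at most once, can spoil
   only one of them. *)
Lemma aligned_edges E k c n k' c' n' (p u q p' u' q' y z : word) :
  cyclic_relator k c n = p ++ u ++ q -> cyclic_relator k' c' n' = p' ++ u' ++ q' ->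
  word_val u' = word_val (y ++ u ++ z) -> size y <= E -> size z <= E ->
  6 * E + 30 <= maxn (size u) (size u') ->
  [/\ k = k', c = c' & exists s t l, [/\ s < size u, t < size u',
     onth (indices c n) (size p + s) = Some l,
     onth (indices c' n') (size p' + t) = Some l
   & core ((word_val y * vert u s)^-1 * vert u' t)]].
Proof.
move=> er er' yuz yE zE long.
have gu : geodesic_word u.
  by apply: (@geodesic_infix _ _ _ _ p u q); rewrite -er; exact: geodesic_cyclic_relator.
have gu' : geodesic_word u'.
  by apply: (@geodesic_infix _ _ _ _ p' u' q'); rewrite -er'; exact: geodesic_cyclic_relator.
have u_long : 4 * E + 30 <= size u.
  move/geodesic_wordP : gu' => /(_ (y ++ u ++ z)); rewrite yuz !size_cat => /(_ erefl).
  lia.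
have at_u s l : s < size u -> onth u s = Some l ->
    exists2 e, onth (indices c n) (size p + s) = Some e & l = ltr k c e.
  move=> su us; have : onth (cyclic_relator k c n) (size p + s) = Some l.
    by rewrite er !onth_cat ltnNge leq_addr addKn /= su.
  by rewrite onth_map; case: onth => [e|] //= [<-]; exists e.
have at_u' t l : t < size u' -> onth u' t = Some l ->
    exists2 e, onth (indices c' n') (size p' + t) = Some e & l = ltr k' c' e.
  move=> su us; have : onth (cyclic_relator k' c' n') (size p' + t) = Some l.
    by rewrite er' !onth_cat ltnNge leq_addr addKn /= su.
  by rewrite onth_map; case: onth => [e|] //= [<-]; exists e.
(* The position of the letter x_k in the relator that contains u. *)
pose j0 := index 0 (indices c n).
pose s0 := if j0 <= size p + (2 * E + 4) then 2 * E + 5 else E + 2.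
have s0E : E.+2 <= s0 <= 2 * E + 5 by rewrite /s0; case: ifP; lia.
have [||s sw|s [t [i [i' [i'' [[ii' i'i''] sw P0 P1 P2]]]]]] :=
    @parallel_run _ _ X H R D hD E u u' y z gu gu' yE zE yuz s0.
- by lia.
- by lia.
- have su : s < size u by lia.
  have : onth u s by rewrite onthTE.
  case us : onth => [l|] // _; have [e ie le] := at_u s l su us.
  have eN := onth_indices ie.
  have [e0|[j ej]|[j ej]] := index_cases eN.
  + have j0E : j0 = size p + s.
      rewrite /j0 -e0 -(@onth_nth _ 0 _ _ _ ie) index_uniq ?uniq_indices //.
      by rewrite -onthTE ie.
    exfalso; move: sw; rewrite /s0 j0E; case: ifP; lia.
  + have [d [ed dl _]] := ltr_a_long k c j.
    by exists i1, d; rewrite le ej ed.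
  + have [d [ed dl _]] := ltr_b_long k c j.
    by exists i2, d; rewrite le ej ed.
have type12 j s1 : H_at j u s1 -> j = i1 \/ j = i2.
  move=> Hj; have rl := H_at_lt Hj; case: Hj => d /(at_u _ _ rl)[e ie de].
  by have [[? [? _ _]]|[? [? _ _]]] := ltr_H (onth_indices ie) (esym de); [left|right].
have [us0 ut0 _] := P0; have [us1 ut1 co1] := P1; have [us2 ut2 co2] := P2.
(* Two cosets, of H_1 and of H_2, meet at each end of the middle edge. *)
have core1 : core ((word_val y * vert u s.+1)^-1 * vert u' t.+1).
  apply: (core_of ii' (type12 _ _ us0) (type12 _ _ us1)) => //.
  exact: coset_trans (parallel_next_coset P0) (H_at_vert ut0).
have core2 : core ((word_val y * vert u s.+2)^-1 * vert u' t.+2).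
  apply: (core_of i'i'' (type12 _ _ us1) (type12 _ _ us2)) => //.
  exact: coset_trans (parallel_next_coset P1) (H_at_vert ut1).
have [su tu'] := (H_at_lt us1, H_at_lt ut1).
have t12 := type12 _ _ us1.
case: us1 => d ud; case: ut1 => d' ud'.
have [e ie de] := at_u _ _ su ud; have [e' ie' de'] := at_u' _ _ tu' ud'.
have cd : core (val d' * (val d)^-1).
  move: core2; rewrite (vertS ud) (vertS ud') /=.
  set z1 := _^-1 * vert u' t.+1 in core1 *; set z2 := _^-1 * _ => core2.
  (* The quadrilateral spanned by the middle edges reads z1 d' = d z2. *)
  have -> : sval d' = z1^-1 * (sval d * z2).
    apply: (mulgI z1); rewrite mulVKg /z1 /z2 (mulgA _ (vert u _)).
    by rewrite [((_ * sval d)^-1)%g]invgM !mulgA mulgV mul1g.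
  have -> : sval d * z2 = z2 * sval d.
    have [dH|dH] : sval d \in H i1 \/ sval d \in H i2.
      by case: t12 => <-; [left | right]; exact: (valP d).
    - exact/esym/core_commute1.
    - exact/esym/core_commute2.
  by rewrite mulgA mulgK coreM // coreV.
have [kk cc ee] := same_index (onth_indices ie) (onth_indices ie') (esym de) (esym de') cd.
split=> //; exists s.+1, t.+1, e; split=> //.
by rewrite ie' ee.
Qed.

Local Notation relators :=
  (symmetrization [set relator (x i) (a i) (b i) | i in [set: K]]).

Lemma symmetrization_C1_A rho : rho <= N -> C1_A rho relators.
Proof.
move=> rN r /symmetrization_cyclic[k [c [n ->]]].
by split; [exact: geodesic_cyclic_relator | rewrite size_cyclic_relator].
Qed.

Context (epsilon mu : R) (E : nat).
Context (le_E : forall n : nat, (n%:R <= epsilon)%R -> n <= E).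
Context (mN : ((6 * E + 30)%N%:R <= mu * N%:R)%R).

(** Writing r = A T A^-1 and r' = A' T A'^-1, where T is the common cyclic shift
   that begins at the aligned letters, the vertices satisfy A' = y A g with g in
   [core], and g commutes with T. *)
Lemma symmetrization_C1_B : C1_B epsilon mu relators.
Proof.
move=> r r' u v u' v' y z /symmetrization_cyclic[k [c [n er]]]
  /symmetrization_cyclic[k' [c' [n' er']]] _ eu eu' long yuz /le_E yzE.
have {}long : 6 * E + 30 <= maxn (size u) (size u').
  rewrite -(ler_nat R); apply: le_trans long.
  by rewrite er er' !size_cyclic_relator minnn.
have [||||kk cc [s [t [l [su tu ls lt cst]]]]] :=
  @aligned_edges E k c n k' c' n' [::] u v [::] u' v' y z _ _ yuz _ _ long.
- by rewrite -er.
- by rewrite -er'.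
- by lia.
- by lia.
subst k' c'; rewrite !add0n in ls lt.
have rots : rot s r = rot t r'.
  rewrite er er' /cyclic_relator -!map_rot /indices; congr map.
  rewrite (rot_uniq_head _ ls) ?(rot_uniq_head _ lt) //;
    by case: (c); rewrite ?rev_uniq iota_uniq.
have comm : commute ((word_val y * vert u s)^-1 * vert u' t) (word_val (rot s r)).
  rewrite er; have [n'' ->] := rot_cyclic_relator s k c n.
  exact: core_commute_cyclic.
have rE : word_val r = vert u s * word_val (rot s r) * (vert u s)^-1.
  rewrite -(vert_catl v (ltnW su)) -eu /vert -mulgA /rot word_val_cat mulgK.
  by rewrite -word_val_cat cat_take_drop.
have r'E : word_val r' = vert u' t * word_val (rot t r') * (vert u' t)^-1.
  rewrite -(vert_catl v' (ltnW tu)) -eu' /vert -mulgA /rot word_val_cat mulgK.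
  by rewrite -word_val_cat cat_take_drop.
rewrite !word_val_cat word_val_inv r'E -rots rE.
set T := word_val (rot s r) in comm *; set A := vert u s in comm *.
set A' := vert u' t in comm *; set Y := word_val y in comm *.
apply: (mulIg A'); rewrite mulgVK.
apply: (mulgI (Y * A)^-1); rewrite [RHS]mulgA comm.
by rewrite invgM !mulgA mulgVK mulVg mul1g.
Qed.

(** Aligned letters of u and u' would be two occurrences of one letter of r; for
   u^-1, they would be letters of opposite signs. *)
Lemma symmetrization_C1_C : C1_C epsilon mu relators.
Proof.
move=> r u u' y z /symmetrization_cyclic[k [c [n er]]] disj yuz /le_E yzE.
rewrite ltNge er size_cyclic_relator; apply/negP => /(le_trans mN).
rewrite ler_nat => long.
have [p [q [p' [q' [e e' dis]]]]] : exists p q p' q',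
    [/\ r = p ++ u ++ q, r = p' ++ u' ++ q' &
      size p + size u <= size p' \/ size p' + size u' <= size p].
  have [p [s [t [e|e]]]] := disj.
    exists p, (s ++ u' ++ t), (p ++ u ++ s), t; rewrite e -!catA.
    by split=> //; left; rewrite !size_cat; lia.
  exists (p ++ u' ++ s), t, p, (s ++ u ++ t); rewrite e -!catA.
  by split=> //; right; rewrite !size_cat; lia.
case: yuz => yuz.
  have [||||_ _ [s [t [l [su tu ls lt _]]]]] :=
    @aligned_edges E k c n k c n p u q p' u' q' y z _ _ yuz _ _ long.
  - by rewrite -er.
  - by rewrite -er.
  - by lia.
  - by lia.
  have si := onthTE (indices c n) (size p + s); rewrite ls /= in si.
  have ti := onthTE (indices c n) (size p' + t); rewrite lt /= in ti.
  have := nth_uniq 0 (esym si) (esym ti) (uniq_indices c n).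
  rewrite (@onth_nth _ 0 _ _ _ ls) (@onth_nth _ 0 _ _ _ lt) eqxx => /esym/eqP.
  by lia.
have [n' en'] := inv_cyclic_relator k c n.
have [|||||_ cc _] := @aligned_edges E k (~~ c) n' k c n (word_inv q) (word_inv u)
    (word_inv p) p' u' q' y z _ _ yuz _ _ _.
- by rewrite -en' -er e !word_inv_cat catA.
- by rewrite -er.
- by lia.
- by lia.
- by rewrite size_word_inv.
by case: (c) cc.
Qed.

End Relators.

(** * Small cancellation *)

Theorem proposition3p6 (R : realType) (G : groupType) (I : Type)
    (H : I -> groupClosed G) (X : invgClosed G)
    (hgen : relative_generating X H)
    (hhyp : weakly_hyperbolic X H R)
    (i1 i2 : I) (hi : i1 <> i2)
    (D : R) (hD : polygon_constant X H D)
    (epsilon : R) (heps : 0 <= epsilon)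
    (mu : R) (hmu : 0 < mu < 1)
    (rho : nat)
    (K : Type) (x : K -> {x : G | x \in X})
    (hx : forall k : K,
      ~ [set (h2 * h1)%g | h2 in [set` H i2] & h1 in [set` H i1]] (val (x k)))
    (hcent : [set` H i1] `&` [set` H i2] `<=`
      centralizer [set` H i1] `&` centralizer [set` H i2] `&`
        \bigcap_(k in [set: K]) centralizer [set val (x k)]) :
  exists M : nat, forall m : nat, (M <= m)%N ->
  forall (a : K -> 'I_m -> {h : G | h \in H i1})
         (b : K -> 'I_m -> {h : G | h \in H i2}),
    (forall (i : K) (j : 'I_m),
      ((50 * D)%:E <= Order.min (dhat X H i1 1%g (val (a i j)))
                                (dhat X H i2 (val (b i j)) 1%g))%E) ->
    (forall (i k : K) (j l : 'I_m) (gamma : bool),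
      ([set` H i1] `&` [set` H i2])
        (val (a k l) * sgnpow (val (a i j)) gamma)%g \/
      ([set` H i1] `&` [set` H i2])
        (val (b k l) * sgnpow (val (b i j)) gamma)%g ->
      [/\ i = k, j = l & gamma = true]) ->
    small_cancellation_C1 epsilon mu rho
      (symmetrization [set relator (x i) (a i) (b i) | i in [set: K]]).
Proof.
have /andP[mu0 _] := hmu.
pose E := Num.bound epsilon.
have le_E (n : nat) : n%:R <= epsilon -> (n <= E)%N.
  move=> /le_lt_trans/(_ (archi_boundP heps)); rewrite ltr_nat; exact: ltnW.
pose L := (6 * E + 30)%N%:R / mu : R.
have L0 : 0 <= L by rewrite divr_ge0 // ltW.
exists (Num.bound L + rho)%N => m mM a b ha hb.
have mN : (6 * E + 30)%N%:R <= mu * (m.*2.+1)%:R :> R.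
  rewrite mulrC -ler_pdivrMr //; apply: le_trans (ltW (archi_boundP L0)) _.
  by rewrite ler_nat; lia.
split.
- by apply: (symmetrization_C1_A hi hD hx ha hb); lia.
- exact: (symmetrization_C1_B hi hD hx hcent ha hb le_E mN).
- exact: (symmetrization_C1_C hi hD hx hcent ha hb le_E mN).
Qed.
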